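(* For all integers $n\ge1$ and $m\ge0$, the number of matchings on $[2n]$ that avoid the pattern $12312$ and have exactly $m$ crossings equals $$\sum_{i=n}^{2n-1}\frac{(-1)^{n+m+i}}{i}\binom{i}{n}\binom{3n}{i+1+n}\binom{i-n}{m}.$$
   Context: A matching on $[2n]$ is a partition of $[2n]$ into $n$ blocks of size two (edges), an edge written $(i,j)$ with $i<j$. Two edges $(i,j),(i',j')$ cross if $i<i'<j<j'$ or $i'<i<j'<j$; the number of crossings of a matching is the number of unordered pairs of its edges that cross. The canonical sequential form of a matching with $n$ edges is the word of length $2n$ obtained by labeling edges $1,\dots,n$ in increasing order of initial points and writing at each position the label of the edge containing it. Words $a_1\cdots a_k$, $b_1\cdots b_k$ are order-isomorphic if $a_i<a_j\iff b_i<b_j$ for all $i,j$. A matching contains a pattern $\tau$ if its canonical sequential form has a subsequence order-isomorphic to $\tau$, and avoids $\tau$ otherwise. *)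

(* Defs.v *)
From HB Require Import structures.
From mathcomp Require Import all_boot all_order all_algebra.
Set Implicit Arguments.
Unset Strict Implicit.
Unset Printing Implicit Defensive.

(* The ground set [2n] is 'I_(2 * n), i.e. {0, ..., 2n - 1}: positions are
   shifted by one, which affects neither crossings nor canonical forms. *)
Definition is_matching (n : nat) (M : {set {set 'I_(2 * n)}}) : bool :=
  [&& partition M [set: 'I_(2 * n)], #|M| == n & [forall B in M, #|B| == 2]].

Definition edges (n : nat) (M : {set {set 'I_(2 * n)}}) :
    {set 'I_(2 * n) * 'I_(2 * n)} :=
  [set e : 'I_(2 * n) * 'I_(2 * n) | (e.1 < e.2) && ([set e.1; e.2] \in M)].

Definition cross (N : nat) (e f : 'I_N * 'I_N) : bool :=
  [&& e.1 < f.1, f.1 < e.2 & e.2 < f.2] || [&& f.1 < e.1, e.1 < f.2 & f.2 < e.2].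

(* Unordered pairs of edges are two-element sets; cross e f forces e != f. *)
Definition crossings (n : nat) (M : {set {set 'I_(2 * n)}}) : nat :=
  #|[set [set e; f] | e in edges M, f in edges M & cross e f]|.

(* The rank (from 1 to n) of f when edges are sorted by initial point. *)
Definition edge_label (n : nat) (M : {set {set 'I_(2 * n)}})
    (f : 'I_(2 * n) * 'I_(2 * n)) : nat :=
  #|[set e in edges M | e.1 <= f.1]|.

(* The default 0 is never used when M is a matching. *)
Definition label_at (n : nat) (M : {set {set 'I_(2 * n)}}) (p : 'I_(2 * n)) : nat :=
  oapp (edge_label M) 0 [pick f in edges M | (p == f.1) || (p == f.2)].

Definition canonical_form (n : nat) (M : {set {set 'I_(2 * n)}}) : seq nat :=
  [seq label_at M p | p <- enum 'I_(2 * n)].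

Definition order_iso (a b : seq nat) : bool :=
  (size a == size b) &&
  [forall i : 'I_(size a), forall j : 'I_(size a),
     (nth 0 a i < nth 0 a j) == (nth 0 b i < nth 0 b j)].

(* Subsequences are given by masks, to keep containment boolean. *)
Definition word_contains (w t : seq nat) : bool :=
  [exists b : (size w).-tuple bool, order_iso (mask b w) t].

Lemma word_containsP (w t : seq nat) :
  reflect (exists2 s : seq nat, subseq s w & order_iso s t) (word_contains w t).
Proof.
apply: (iffP existsP) => [[b bt]|[s /subseqP[b /eqP sb ->] st]].
  by exists (mask b w) => //; exact: mask_subseq.
by exists (Tuple sb).
Qed.

Definition avoids (n : nat) (M : {set {set 'I_(2 * n)}}) (t : seq nat) : bool :=
  ~~ word_contains (canonical_form M) t.

(* Main.v *)
Require Import Defs.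
From HB Require Import structures.
From mathcomp Require Import all_boot all_order all_algebra.
From mathcomp Require Import ring zify.
Set Implicit Arguments.
Unset Strict Implicit.
Unset Printing Implicit Defensive.
Import Order.TTheory GRing.Theory Num.Theory.

(* Read a matching from left to right, keeping the stack of open edges. Closing
   an edge crosses exactly the open edges above it in the stack, and 12312 is
   avoided iff every such crossed edge is the most recently opened one. So each
   closing step takes the top of the stack (no crossing), or, when the top is
   the most recently opened edge, the entry just below it (one crossing).

   Let S_h be the generating function, in q for crossings and x for opened
   edges, of the histories ending with h open edges, and B_h that of those whose
   most recently opened edge is still open. Then B_0 = 0, S_0 = 1 + S_1,
     S_h = S_(h+1) + B_h   and   B_h = x S_(h-1) + q B_(h+1)   for h > 0,
   which is solved by S_h = t^h (1 + t)^(1 - h), where t is the power series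
   with t (1 - (q - 1) t) = x (1 + t)^3. Lagrange inversion predicts the
   coefficients of S_h and B_h; these closed forms are checked against the
   recurrences, and h = 0 gives the theorem. *)

(** * Codes of matchings *)

(* The entry of the newest point comes first; [None] stands for an initial
   point, [Some a] for the terminal point of the edge starting at [a]. *)
Definition code := seq (option nat).

Fixpoint stack (v : code) : seq nat :=
  match v with
  | [::] => [::]
  | None :: v' => size v' :: stack v'
  | Some a :: v' => rem a (stack v')
  end.

Fixpoint valid (v : code) : bool :=
  match v with
  | [::] => true
  | None :: v' => valid v'
  | Some a :: v' => (a \in stack v') && valid v'
  end.

(* Is the most recently opened edge still open? *)
Fixpoint fresh (v : code) : bool :=
  match v with
  | [::] => false
  | None :: v' => true
  | Some a :: v' => fresh v' && (0 < index a (stack v'))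
  end.

(** The bound [fresh v'] is a boolean read as 0 or 1: index 0 is always allowed, index 1 only if the
    top of the stack is the most recently opened edge. *)
Fixpoint good (v : code) : bool :=
  match v with
  | [::] => true
  | None :: v' => good v'
  | Some a :: v' =>
      [&& a \in stack v', (index a (stack v') <= fresh v') & good v']
  end.

Fixpoint ncross (v : code) : nat :=
  match v with
  | [::] => 0
  | None :: v' => ncross v'
  | Some a :: v' => (index a (stack v') + ncross v')
  end.

Definition extensions (v : code) : seq code :=
  (None :: v) ::
  [seq Some a :: v | a <- take (fresh v).+1 (stack v)].

Fixpoint good_codes (p : nat) : seq code :=
  if p is p'.+1 then flatten [seq extensions v | v <- good_codes p']
  else [:: [::]].

Lemma stack_lt_size v i : i \in stack v -> (i < size v).
Proof.
elim: v => //= -[a|] v IH /=; first by move/mem_rem/IH/ltnW.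
by rewrite inE => /predU1P[->|/IH/ltnW].
Qed.

Lemma stack_uniq v : uniq (stack v).
Proof.
elim: v => //= -[a|] v IH /=; first exact: rem_uniq.
by rewrite IH andbT; apply/negP => /stack_lt_size; rewrite ltnn.
Qed.

Lemma size_stack v : (size (stack v) <= size v).
Proof.
elim: v => //= -[a|] v IH //=; apply: leq_trans (leqW IH).
by rewrite size_subseq // rem_subseq.
Qed.

Lemma good_codesP p v : (v \in good_codes p) = (size v == p) && good v.
Proof.
elim: p v => [|p IH] v; first by case: v.
apply/flatten_mapP/andP => /= [[u]|].
  rewrite IH => /andP[/eqP szu gu]; rewrite inE => /predU1P[->|].
    by rewrite /= szu.
  case/mapP => a ain -> /=; rewrite szu gu andbT eqxx; split=> //.
  by have ins := mem_take ain; rewrite ins /= -ltnS -in_take.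
case: v => [|x v] /= [] // szv gxv; exists v.
  by rewrite IH -eqSS szv; case: x gxv => // a /and3P[].
rewrite inE; case: x gxv szv => [a /and3P[ins le _] _|_ _]; last by rewrite eqxx.
by rewrite map_f ?orbT // in_take // ltnS.
Qed.

(** The tail of an extension is the code it extends, so different codes have disjoint lists of
    extensions. *)
Lemma good_codes_uniq p : uniq (good_codes p).
Proof.
elim: p => //= p IH.
have ue v : uniq (extensions v).
  rewrite /= map_inj_uniq ?take_uniq ?stack_uniq ?andbT //.
    by apply/mapP => -[].
  by move=> a b [].
elim: (good_codes p) IH => [//|v s IHs] /andP[vs us].
rewrite -[flatten _]/(extensions v ++ flatten [seq extensions w | w <- s]).
rewrite cat_uniq ue IHs //.
rewrite andbT; apply/hasPn => u /flatten_mapP[w ws uw].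
have tl x y : x \in extensions y -> behead x = y.
  by rewrite inE => /predU1P[->|/mapP[? _ ->]].
by apply/negP => /tl eqv; rewrite -(tl _ _ uw) eqv (negPf vs) in ws.
Qed.

(** * Fixed-point-free involutions and their codes *)

Definition fpf_involution (N : nat) (g : nat -> nat) : Prop :=
  forall i, i < N -> [/\ g i < N, g (g i) = i & g i != i].

Fixpoint code_of (g : nat -> nat) (p : nat) : code :=
  if p is p'.+1
  then (if g p' < p' then Some (g p') else None) :: code_of g p'
  else [::].

Fixpoint down (p : nat) : seq nat := if p is p'.+1 then p' :: down p' else [::].

Lemma mem_down p i : (i \in down p) = (i < p).
Proof. by elim: p => //= p IH; rewrite inE IH [RHS]ltnS [RHS]leq_eqVlt. Qed.

Lemma down_uniq p : uniq (down p).
Proof. by elim: p => //= p ->; rewrite mem_down ltnn. Qed.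

Lemma size_code_of g p : size (code_of g p) = p.
Proof. by elim: p => //= p ->. Qed.

(** In a decreasing list the entries before [a] are exactly the larger ones. *)
Lemma index_down (P : pred nat) a p : a < p -> P a ->
  index a [seq i <- down p | P i] = #|[pred b : 'I_p | (a < b) && P b]|.
Proof.
rewrite -sum1_card big_mkcond /=.
elim: p => //= p IH; rewrite ltnS leq_eqVlt big_ord_recr /= inE /=.
case/predU1P => [-> Pp|ap Pa].
  rewrite Pp /= eqxx ltnn big1 // => b _.
  by rewrite inE /= ltnNge ltnW.
rewrite ap; case: ifP => Pp /=; rewrite ?addn0 -?IH //.
by rewrite gtn_eqF // addn1 IH.
Qed.

Section CodeOf.

Variables (N : nat) (g : nat -> nat).
Hypothesis g_inv : fpf_involution N g.

(** For [i < p], the condition [p <= g i] says that an edge opened at [i] is not yet closed. When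
    [p] is a terminal point, passing to [p.+1] removes only [g p]. *)
Lemma stack_code_of p : p <= N ->
  stack (code_of g p) = [seq i <- down p | p <= g i].
Proof.
elim: p => //= p IH pN; have [gpN ggp gpp] := g_inv pN.
case: ltnP => gp /=; rewrite (IH (ltnW pN)) //; last first.
  have ltg : p < g p by rewrite ltn_neqAle eq_sym gpp.
  rewrite size_code_of ltg; congr cons; apply: eq_in_filter => i.
  rewrite mem_down [p <= _]leq_eqVlt => ip; case: eqP => //= gi.
  have [_ ggi _] := g_inv (ltn_trans ip pN).
  by move: ggi; rewrite -gi; lia.
rewrite [p < g p]ltnNge (ltnW gp) rem_filter ?filter_uniq ?down_uniq // -filter_predI.
apply: eq_in_filter => i; rewrite mem_down => ip /=.
have [_ ggi _] := g_inv (ltn_trans ip pN).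
rewrite [RHS]ltn_neqAle; congr (~~ _ && _).
by apply/eqP/eqP => [->|->].
Qed.

Lemma valid_code_of p : p <= N -> valid (code_of g p).
Proof.
elim: p => //= p IH pN; have [gpN ggp gpp] := g_inv pN.
case: ltnP => gp /=; rewrite (IH (ltnW pN)) // andbT (stack_code_of (ltnW pN)) //.
by rewrite mem_filter ggp leqnn mem_down.
Qed.

Lemma stack_code_of_full : stack (code_of g N) = [::].
Proof.
rewrite stack_code_of // (eq_in_filter (a2 := pred0)) ?filter_pred0 //.
by move=> i; rewrite mem_down => iN; have [giN _ _] := g_inv iN; rewrite leqNgt giN.
Qed.

Lemma index_code_of q : q < N -> g q < q ->
  index (g q) (stack (code_of g q)) =
  #|[pred b : 'I_q | (g q < b) && (q <= g b)]|.
Proof.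
move=> qN gq; have [_ ggq _] := g_inv qN.
by rewrite (stack_code_of (ltnW qN)) index_down // ggq.
Qed.

Lemma fresh_code_of p : p <= N ->
  fresh (code_of g p) <->
  exists o, [/\ o < p, p <= g o & forall x, o < x < p -> g x < x].
Proof.
elim: p => [|p IH] pN /=; first by split=> // -[o []].
have [gpN ggp gpp] := g_inv pN.
case: ltnP => gp /=; last first.
  split=> // _; exists p; split; rewrite // ?ltn_neqAle 1?eq_sym ?gpp //.
  by move=> x; lia.
rewrite index_code_of //; split.
  case/andP => /(IH (ltnW pN))[o [op go cl]] /card_gt0P[b].
  rewrite inE => /andP[ab pb]; exists o; split; first by lia.
    rewrite ltn_neqAle go andbT; apply/eqP => pgo.
    have [_ ggo _] := g_inv (ltn_trans op pN).
    have gpo : g p = o by rewrite [in LHS]pgo.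
    have := cl b; rewrite -gpo ab ltn_ord => /(_ isT).
    by have := ltn_ord b; lia.
  move=> x /andP[ox]; rewrite ltnS leq_eqVlt => /predU1P[->//|xp].
  by apply: cl; rewrite ox.
case=> o [op go cl].
have {}op : o < p.
  by rewrite ltn_neqAle -ltnS op andbT; apply/eqP => oE; move: go; rewrite oE; lia.
apply/andP; split.
  apply/(IH (ltnW pN)); exists o; split=> //; first exact: ltnW.
  by move=> x xop; apply: cl; lia.
apply/card_gt0P; exists (Ordinal op); rewrite inE /= (ltnW go) andbT.
(* [o] lies strictly above [g p]: it is not [g p], which is closed at [p], and [g p] is an initial
   point, so it cannot come after [o]. *)
rewrite ltnNge leq_eqVlt; apply/negP => /predU1P[oE|ogp].
  by move: go; rewrite oE ggp ltnn.
by have := cl (g p); rewrite ogp ggp => /(_ _); lia.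
Qed.

(* Closing [q] crosses the edges opened in [(g q, q)] and closed after [q]; such
   a crossing extends to 12312 iff another edge opens before [q]. *)
Lemma closer_step_code_of q : q < N -> g q < q ->
  index (g q) (stack (code_of g q)) <= fresh (code_of g q) <->
  (forall b c, g q < b -> b < c -> c < q -> q < g b -> g c < c).
Proof.
move=> qN gq; rewrite index_code_of //; have [_ ggq _] := g_inv qN; split.
  move=> le b c ab bc cq gb; rewrite ltnNge; apply/negP => cgc.
  have bq : b < q by lia.
  have b_in : Ordinal bq \in [pred b : 'I_q | (g q < b) && (q <= g b)].
    by rewrite inE /= ab ltnW.
  have fl : fresh (code_of g q).
    have : 0 < #|[pred b : 'I_q | (g q < b) && (q <= g b)]|.
      by apply/card_gt0P; exists (Ordinal bq).
    by case: (fresh _) le => //; rewrite leqn0 => /eqP ->.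
  (* The last initial point [o] before [q] is not before the initial point [c]. So [b < o], both are
     open above [g q], and the index is at least 2. *)
  have [o [oq go cl]] := proj1 (fresh_code_of (ltnW qN)) fl.
  have co : c <= o.
    by rewrite leqNgt; apply/negP => oc; have := cl c; rewrite oc cq => /(_ isT); lia.
  have : 1 < #|[pred b : 'I_q | (g q < b) && (q <= g b)]|.
    apply/card_gt1P; exists (Ordinal bq), (Ordinal oq); split=> //.
      by rewrite inE /= go andbT; lia.
    by rewrite -val_eqE /=; lia.
  by rewrite fl in le; lia.
move=> av; have [->//|pos] := posnP #|[pred b : 'I_q | (g q < b) && (q <= g b)]|.
(* All points between a counted [b] and [q] are terminal by hypothesis, so [b] is the most recently
   opened edge. *)
have -> : fresh (code_of g q).
  apply/(fresh_code_of (ltnW qN)); case/card_gt0P: pos => b.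
  rewrite inE => /andP[ab gb]; exists b; split=> // x /andP[bx xq].
  apply: (av b) => //; rewrite ltn_neqAle gb andbT; apply/eqP => qE.
  have bN : b < N by rewrite (ltn_trans (ltn_ord b)).
  by have [_] := g_inv bN; rewrite -qE; lia.
rewrite leqNgt; apply/negP => /card_gt1P[b [c []]].
wlog bc : b c / b < c.
  move=> hw bin cin bc; have := bc; rewrite -val_eqE neq_ltn => /orP[lt|lt].
    exact: (hw b c).
  by apply: (hw c b) => //; rewrite eq_sym.
rewrite !inE => /andP[ab gb] /andP[ac gc] _.
have := av b c ab bc (ltn_ord c); have := ltn_ord c.
have bN : b < N by rewrite (ltn_trans (ltn_ord b)).
have := g_inv bN => -[_ ggb _].
have : g b != q by apply/eqP => gbq; move: ggb; rewrite gbq; lia.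
lia.
Qed.

(** A violation consists of positions [g q < b < c < q < g b] with [c] an initial point; these carry
    the labels of a pattern 12312. *)
Lemma good_code_of p : p <= N ->
  good (code_of g p) <->
  (forall q b c, q < p -> g q < b -> b < c -> c < q -> q < g b -> g c < c).
Proof.
elim: p => [|p IH] pN; first by split.
have {}IH := IH (ltnW pN).
have step : good (if g p < p then Some (g p) :: code_of g p else None :: code_of g p)
   <-> good (code_of g p) /\ (g p < p ->
  (forall b c, g p < b -> b < c -> c < p -> p < g b -> g c < c)).
  case: ifP => gp /=; last by split=> [|[]].
  have := valid_code_of pN; rewrite /= gp /= => /andP[-> _] /=.
  split=> [/andP[i_le ->]|[-> av]].
    by split=> // _; apply/(closer_step_code_of pN gp).
  by rewrite andbT; apply/(closer_step_code_of pN gp)/av.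
have -> : code_of g p.+1 =
   if g p < p then Some (g p) :: code_of g p else None :: code_of g p.
  by rewrite /=; case: ifP.
split=> [/step[/IH av1 av2] q b c|av].
  rewrite ltnS leq_eqVlt => /predU1P[->|qp]; last exact: av1.
  by move=> pb bc cp; apply: av2 => //; lia.
apply/step; split; first by apply/IH => q b c qp; apply: av; lia.
by move=> gp b c; apply: av.
Qed.

Lemma ncross_code_of p : p <= N ->
  ncross (code_of g p) =
  \sum_(q < p | g q < q) #|[pred b : 'I_q | (g q < b) && (q <= g b)]|.
Proof.
elim: p => [|p IH] pN /=; first by rewrite big_ord0.
rewrite big_mkcond big_ord_recr /= -big_mkcond /= -(IH (ltnW pN)) //.
by case: ifP => gp /=; rewrite ?addn0 // index_code_of // addnC.
Qed.

End CodeOf.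

(** * Decoding: the involution of a valid code with empty final stack *)

Fixpoint letter (v : code) (i : nat) : option nat :=
  if v is x :: v' then if i == size v' then x else letter v' i else None.

(** The two claims need a joint induction: [Some a] points back to an initial point because [a] is
    on the stack, and describing the stack uses the bound on the positions of such entries. *)
Lemma letter_stack v : valid v ->
  (forall c a, letter v c = Some a -> [/\ a < c, c < size v & letter v a = None])
  /\ (forall i, i \in stack v <->
       [/\ i < size v, letter v i = None & forall c, letter v c <> Some i]).
Proof.
elim: v => [_|x v IH]; first by split=> // i; split=> // -[].
case: x => [a|] /=; last first.
  case/IH => h1 h2; split=> [c b|i].
    case: eqP => // _ /h1[bc cv lb]; rewrite ltnS (ltnW cv) ltn_eqF //.
    exact: ltn_trans bc cv.
  split=> [|[iv li nli]].
    rewrite inE => /predU1P[->|/h2[iv li nli]].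
      rewrite ltnSn eqxx; split=> // c; case: eqP => // _ /h1[]; lia.
    rewrite ltnS ltnW // ltn_eqF //; split=> // c.
    by case: eqP => // _; apply: nli.
  rewrite inE; case: eqP li => //= iN li; apply/h2; split=> //.
    by rewrite ltn_neqAle -ltnS iv andbT; apply/eqP.
  move=> c lc; have [_ cv _] := h1 _ _ lc.
  by apply: (nli c); rewrite ltn_eqF.
case/andP => av /IH[h1 h2]; split=> [c b|i].
  case: eqP => [-> [<-]|_ /h1[bc cv lb]].
    by case/h2: av => av la _; rewrite av ltnSn ltn_eqF.
  by rewrite ltnS (ltnW cv) ltn_eqF //; exact: ltn_trans bc cv.
rewrite mem_rem_uniq ?stack_uniq // !inE; split.
  case/andP => /eqP ia /h2[iv li nli]; rewrite ltnS ltnW // ltn_eqF //.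
  by split=> // c; case: eqP => [_ [] /esym|_]; last exact: nli.
case=> iv; case: eqP => // /eqP iN li nli; apply/andP; split.
  by apply/eqP => ia; apply: (nli (size v)); rewrite eqxx ia.
apply/h2; split=> //; first by rewrite ltn_neqAle iN -ltnS.
move=> c lc; have [_ cv _] := h1 _ _ lc.
by apply: (nli c); rewrite ltn_eqF.
Qed.

(** A start is closed only while on the stack, and the stack holds no start that was closed
    before. *)
Lemma letter_inj v a c d : valid v ->
  letter v c = Some a -> letter v d = Some a -> c = d.
Proof.
elim: v => // x v IH vv.
have vv' : valid v by case: x vv => [b /andP[]|].
have nin b e : valid (Some b :: v) -> letter v e <> Some b.
  by case/andP => bv _; case/(proj2 (letter_stack vv')): bv.
case: x vv => [b|] vv /=; case: eqP => [->|_]; case: eqP => [->|_] //.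
- by move=> [<-] /nin; case.
- by move=> + [ba]; rewrite -ba => /nin; case.
- exact: IH.
exact: IH.
Qed.

Lemma code_ofE g v :
  (forall i, i < size v -> letter v i = if g i < i then Some (g i) else None) ->
  v = code_of g (size v).
Proof.
elim: v => //= x v IH eqg; congr cons.
  by have := eqg (size v); rewrite eqxx => ->.
apply: IH => i iv; have := eqg i; rewrite ltn_eqF // => -> //; exact: ltnW.
Qed.

Definition partner (v : code) (i : nat) : nat :=
  if letter v i is Some a then a
  else find (fun c => letter v c == Some i) (iota 0 (size v)).

Section Partner.

Variable v : code.
Hypotheses (v_valid : valid v) (v_closed : stack v = [::]).

(** A start that is never closed would remain on the final stack, which is empty. *)
Lemma partner_opener i : i < size v -> letter v i = None ->
  letter v (partner v i) = Some i.
Proof.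
move=> iv li; rewrite /partner li; set P := fun c => _.
have hP : has P (iota 0 (size v)).
  apply: contraT => /hasPn nh; have : i \in stack v.
    apply/(proj2 (letter_stack v_valid)); split=> // c lc.
    suff /nh : c \in iota 0 (size v) by rewrite /P lc eqxx.
    by rewrite mem_iota /=; case: (proj1 (letter_stack v_valid) _ _ lc).
  by rewrite v_closed.
apply/eqP; have := nth_find 0 hP.
by rewrite nth_iota ?add0n // -[X in _ < X](size_iota 0) -has_find.
Qed.

Lemma partner_fpf_involution : fpf_involution (size v) (partner v).
Proof.
move=> i iv; have [h1 _] := letter_stack v_valid.
case li: (letter v i) => [a|].
  have [ai _ la] := h1 _ _ li; have av := ltn_trans ai iv.
  have -> : partner v i = a by rewrite /partner li.
  split=> //; last by rewrite ltn_eqF.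
  exact: letter_inj (partner_opener av la) li.
have lp := partner_opener iv li; have [ip pv _] := h1 _ _ lp.
split=> //; last by rewrite gtn_eqF.
by rewrite {1}/partner lp.
Qed.

Lemma code_of_partner : code_of (partner v) (size v) = v.
Proof.
apply/esym/code_ofE => i iv; have [h1 _] := letter_stack v_valid.
case li: (letter v i) => [a|].
  by have [ai _ _] := h1 _ _ li; rewrite /partner li ai.
have [ip _ _] := h1 _ _ (partner_opener iv li).
by rewrite ltnNge ltnW.
Qed.

End Partner.

(** The code records [g] at terminal points; at an initial point [g] is recovered through its
    terminal partner. *)
Lemma code_of_inj N g g' : fpf_involution N g -> fpf_involution N g' ->
  code_of g N = code_of g' N -> forall i, i < N -> g i = g' i.
Proof.
move=> gI gI' eqc.
have closer q : q < N -> g q < q -> g' q = g q.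
  elim: (N) q eqc => //= p IH q [eqp /IH{}IH]; rewrite ltnS leq_eqVlt.
  case/predU1P => [->|]; last exact: IH.
  by move=> gp; move: eqp; rewrite gp; case: ifP => // _ [].
move=> i iN; have [giN ggi gii] := gI _ iN.
have [lt|ge] := ltnP (g i) i; first by rewrite closer.
have := closer _ giN; rewrite ggi ltn_neqAle eq_sym gii ge => /(_ isT) g'gi.
by have [_ + _] := gI' _ giN; rewrite g'gi.
Qed.

Lemma valid_good v : good v -> valid v.
Proof. by elim: v => //= -[a|] v IH //= /and3P[-> _ /IH]. Qed.

(** * Matchings on [2n] *)

Lemma sorted_enum_ord k : sorted (fun i j : 'I_k => i < j) (enum 'I_k).
Proof. by have := iota_ltn_sorted 0 k; rewrite -val_enum_ord sorted_map. Qed.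

Section Matching.

Variable n : nat.
Local Notation N := (2 * n).
Implicit Types (M : {set {set 'I_N}}) (i j p q : 'I_N).

Definition mate M i : 'I_N :=
  odflt i [pick j | (j != i) && ([set i; j] \in M)].

Definition mate_nat M (k : nat) : nat :=
  if insub k is Some i then val (mate M i) else k.

Lemma mate_natE M i : mate_nat M i = mate M i.
Proof. by rewrite /mate_nat valK. Qed.

Lemma set2_injr i j j' : j != i -> [set i; j] = [set i; j'] -> j = j'.
Proof.
move=> ji /setP/(_ j); rewrite !inE eqxx orbT (negPf ji) /= => /esym/eqP.
by [].
Qed.

Lemma mateP M i : is_matching M -> mate M i != i /\ [set i; mate M i] \in M.
Proof.
case/and3P => /and3P[/eqP cov _ _] _ /forallP sz.
rewrite /mate; case: pickP => [j /andP[]|no] //=.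
have : i \in cover M by rewrite cov inE.
case/bigcupP => B BM iB; have := sz B; rewrite BM /= => /cards2P[x [y [xy BE]]].
move: no iB BM; rewrite BE !inE => + /orP[]/eqP iE BM; rewrite iE => no.
  by have := no y; rewrite eq_sym xy BM.
by have := no x; rewrite xy setUC BM.
Qed.

Lemma mate_unique M i j : is_matching M -> j != i -> [set i; j] \in M ->
  mate M i = j.
Proof.
move=> Mm ji ijM; have [mi miM] := mateP i Mm.
apply: (set2_injr mi); case/and3P: Mm => /and3P[_ triv _] _ _.
have pb B : B \in M -> i \in B -> pblock M i = B by exact: def_pblock.
by rewrite -(pb _ miM) ?(pb _ ijM) // !inE eqxx.
Qed.

Lemma mateK M : is_matching M -> involutive (mate M).
Proof.
move=> Mm i; have [mi miM] := mateP i Mm.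
by apply: mate_unique => //; rewrite 1?eq_sym // setUC.
Qed.

Lemma mate_natP M : is_matching M -> fpf_involution N (mate_nat M).
Proof.
move=> Mm k kN; rewrite -[k]/(val (Ordinal kN)) !mate_natE mateK //.
by split=> //; case: (mateP (Ordinal kN) Mm).
Qed.

Lemma matching_mate M : is_matching M -> M = [set [set i; mate M i] | i : 'I_N].
Proof.
move=> Mm; apply/setP => B; apply/idP/imsetP => [BM|[i _ ->]]; last first.
  by case: (mateP i Mm).
case/and3P: (Mm) => _ _ /forallP/(_ B); rewrite BM => /cards2P[x [y [xy BE]]].
exists x => //; rewrite BE (mate_unique _ _ (_ : [set x; y] \in M)) -?BE //.
by rewrite eq_sym.
Qed.

(** The blocks are the orbits of [g]. There are [n] of them, since blocks of size two partition
    [2 * n] points. *)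
Lemma exists_matching (g : nat -> nat) : fpf_involution N g ->
  exists2 M : {set {set 'I_N}}, is_matching M & forall k, k < N -> mate_nat M k = g k.
Proof.
move=> gI.
have gN (i : 'I_N) : g i < N by case: (gI i (ltn_ord i)).
pose G i := Ordinal (gN i).
have GK : involutive G by move=> i; apply/val_inj; case: (gI i (ltn_ord i)).
have Gn i : G i != i by rewrite -val_eqE; case: (gI i (ltn_ord i)).
pose M := [set [set i; G i] | i : 'I_N].
have blk i j : i \in [set j; G j] -> [set j; G j] = [set i; G i].
  by rewrite !inE => /orP[]/eqP->; rewrite // GK setUC.
have part : partition M [set: 'I_N].
  apply/and3P; split.
  - apply/eqP/setP => i; rewrite inE.
    have ii : i \in [set i; G i] by rewrite !inE eqxx.
    by apply/bigcupP; exists [set i; G i]; first exact: imset_f.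
  - apply/trivIsetP => _ _ /imsetP[i _ ->] /imsetP[j _ ->] ij.
    apply/pred0P => k /=; apply/negP => /andP[/blk ki /blk kj].
    by rewrite ki kj eqxx in ij.
  - apply/negP => /imsetP[i _] E.
    by have := set21 i (G i); rewrite -E inE.
have sz2 B : B \in M -> #|B| = 2.
  by case/imsetP => i _ ->; rewrite cards2 eq_sym Gn.
have Mm : is_matching M.
  rewrite /is_matching part /=; apply/andP; split; last first.
    by apply/forallP => B; apply/implyP => /sz2 ->.
  have := card_uniform_partition sz2 part.
  by rewrite cardsT card_ord; move: #|M| => k kE; apply/eqP; lia.
exists M => // k kN; rewrite -[k]/(val (Ordinal kN)) mate_natE.
by rewrite (@mate_unique M _ (G (Ordinal kN))) //; exact: imset_f.
Qed.

Definition matching_code M : code := code_of (mate_nat M) N.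

Lemma matching_code_inj M M' : is_matching M -> is_matching M' ->
  matching_code M = matching_code M' -> M = M'.
Proof.
move=> Mm Mm' /(code_of_inj (mate_natP Mm) (mate_natP Mm')) eqm.
rewrite (matching_mate Mm) (matching_mate Mm'); apply: eq_imset => i.
by congr [set i; _]; apply: val_inj; rewrite /= -!mate_natE eqm.
Qed.

Lemma matching_code_surj v : size v = N -> valid v -> stack v = [::] ->
  exists2 M : {set {set 'I_N}}, is_matching M & matching_code M = v.
Proof.
move=> sz vv sv; have := partner_fpf_involution vv sv; rewrite sz.
case/exists_matching => M Mm mE; exists M => //.
rewrite -[RHS](code_of_partner vv sv) sz /matching_code.
by elim: (N) mE => //= p IH mE; rewrite mE // IH // => k kp; rewrite mE // ltnW.
Qed.

Lemma in_edges M e : is_matching M ->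
  (e \in edges M) = (e.1 < e.2) && (mate M e.1 == e.2).
Proof.
case: e => i j Mm; rewrite inE /=; apply: andb_id2l => ij.
have ji : j != i by rewrite -val_eqE gtn_eqF.
apply/idP/eqP => [/(mate_unique Mm ji)//|<-].
by case: (mateP i Mm).
Qed.

(** * Labels, the pattern 12312 and crossings in terms of [mate] *)

Definition opener M p : 'I_N := if p < mate M p then p else mate M p.

Lemma opener_lt M p : is_matching M -> opener M p < mate M (opener M p).
Proof.
move=> Mm; rewrite /opener; case: (ltnP p (mate M p)) => // ge.
rewrite mateK // ltn_neqAle ge andbT.
by have [] := mateP p Mm; rewrite val_eqE.
Qed.

Lemma opener_cases M p : is_matching M ->
  p = opener M p \/ p = mate M (opener M p).
Proof. by move=> Mm; rewrite /opener; case: ifP; rewrite ?mateK //; [left|right]. Qed.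

Lemma opener_id M p : p < mate M p -> opener M p = p.
Proof. by rewrite /opener => ->. Qed.

Lemma opener_mate M p : is_matching M -> opener M (mate M p) = opener M p.
Proof.
move=> Mm; rewrite /opener mateK //; case: ltngtP => // /val_inj E.
by have [] := mateP p Mm; rewrite E eqxx.
Qed.

Lemma opener_le M p : opener M p <= p.
Proof. by rewrite /opener; case: (ltnP p (mate M p)). Qed.

Lemma label_at_opener M p : is_matching M ->
  label_at M p = edge_label M (opener M p, mate M (opener M p)).
Proof.
move=> Mm; rewrite /label_at; case: pickP => [[i j]|no] /=.
  rewrite in_edges //= => /andP[/andP[ij /eqP jE] pE]; rewrite -{}jE in ij pE *.
  suff -> : opener M p = i by [].
  have oi := opener_id ij.
  by case/orP: pE => /eqP->; rewrite ?opener_mate.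
have := no (opener M p, mate M (opener M p)).
rewrite in_edges //= opener_lt // eqxx /=.
by case: (opener_cases p Mm) => <-; rewrite eqxx ?orbT.
Qed.

(** The set of edges counted by a label grows with the initial point, and strictly so when a later
    initial point is reached. *)
Lemma label_at_lt M p q : is_matching M ->
  (label_at M p < label_at M q) = (opener M p < opener M q).
Proof.
move=> Mm; rewrite !label_at_opener // /edge_label /=.
have mono (i j : 'I_N) : i <= j ->
    [set e in edges M | e.1 <= i] \subset [set e in edges M | e.1 <= j].
  move=> ij; apply/subsetP => e; rewrite !inE => /andP[-> /=] ei.
  exact: leq_trans ei ij.
have [lt|ge] := ltnP (opener M p) (opener M q); last first.
  by apply/negbTE; rewrite -leqNgt subset_leq_card // mono.
apply/proper_card/properP; split; first exact: mono (ltnW lt).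
exists (opener M q, mate M (opener M q)); rewrite inE in_edges //= opener_lt //.
  by rewrite eqxx /=.
by rewrite eqxx /= -ltnNge.
Qed.

Lemma contains_12312 M : is_matching M ->
  word_contains (canonical_form M) [:: 1; 2; 3; 1; 2] <->
  exists a b c : 'I_N,
    [/\ a < b, b < c, c < mate M a, mate M a < mate M b & c < mate M c].
Proof.
move=> Mm; split.
  case/existsP => -[bs sz]; rewrite /canonical_form -map_mask.
  set t := mask _ _; have tsort : sorted (fun i j : 'I_N => i < j) t.
    apply: sorted_mask; first by move=> ? ? ?; exact: ltn_trans.
    exact: sorted_enum_ord.
  case/andP => /eqP; rewrite size_map.
  case: t tsort => [|p1 [|p2 [|p3 [|p4 [|p5 [|]]]]]] //=.
  case/and5P => p12 p23 p34 p45 _ _ /forallP iso.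
  have cmp (x y : 'I_5) : (label_at M (nth p1 [:: p1; p2; p3; p4; p5] x)
       < label_at M (nth p1 [:: p1; p2; p3; p4; p5] y))
      = (nth 0 [:: 1; 2; 3; 1; 2] x < nth 0 [:: 1; 2; 3; 1; 2] y).
    have /forallP/(_ y)/eqP <- := iso x.
    rewrite -!(nth_map p1 0 (label_at M)) //=; exact: ltn_ord.
  have c12 := cmp (@Ordinal 5 0 isT) (@Ordinal 5 1 isT).
  have c23 := cmp (@Ordinal 5 1 isT) (@Ordinal 5 2 isT).
  have c14 := cmp (@Ordinal 5 0 isT) (@Ordinal 5 3 isT).
  have c41 := cmp (@Ordinal 5 3 isT) (@Ordinal 5 0 isT).
  have c25 := cmp (@Ordinal 5 1 isT) (@Ordinal 5 4 isT).
  have c52 := cmp (@Ordinal 5 4 isT) (@Ordinal 5 1 isT).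
  rewrite !label_at_lt //= in c12 c23 c14 c41 c25 c52.
  (* Positions whose labels are incomparable lie on one edge; since [p < q], they are its initial
     and terminal points. *)
  have same (p q : 'I_N) : p < q -> (opener M p < opener M q) = false ->
      (opener M q < opener M p) = false -> opener M p = p /\ mate M p = q.
    move=> pq /negbT; rewrite -leqNgt => o1 /negbT; rewrite -leqNgt => o2.
    have oE : opener M p = opener M q by apply/val_inj/eqP; rewrite eqn_leq o1 o2.
    case: (opener_cases p Mm) (opener_cases q Mm) => [pE|pE] [qE|qE].
    - by move: pq; rewrite pE qE oE ltnn.
    - by split; rewrite // [in LHS]pE oE.
    - by have := opener_le M p; rewrite oE -qE; lia.
    - by move: pq; rewrite pE qE oE ltnn.
  have [o1 m1] := same _ _ (ltn_trans (ltn_trans p12 p23) p34) c14 c41.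
  have [o2 m2] := same _ _ (ltn_trans (ltn_trans p23 p34) p45) c25 c52.
  (* The 3 may be read at a terminal point. The initial point of its edge is still after [p2],
     because its label exceeds the label at [p2]. *)
  exists p1, p2, (opener M p3); rewrite m1 m2; split=> //.
  - by rewrite -o2.
  - exact: leq_ltn_trans (opener_le _ _) p34.
  - exact: opener_lt.
case=> a [b [c [ab bc cd de oc]]].
have [ac bd] : a < c /\ b < mate M a by lia.
have oa : a < mate M a by lia.
have ob : b < mate M b by lia.
pose t := [:: a; b; c; mate M a; mate M b].
apply/word_containsP; exists [seq label_at M p | p <- t].
  (* Since [t] is strictly increasing, it is the full list of positions filtered by membership in
     [t]. *)
  apply: map_subseq; rewrite (_ : t = [seq p <- enum 'I_N | p \in t]) ?filter_subseq //.
  apply: (@irr_sorted_eq _ (fun i j : 'I_N => i < j)).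
  - by move=> ? ? ?; exact: ltn_trans.
  - by move=> ?; rewrite /= ltnn.
  - by rewrite /= ab bc cd de.
  - apply: sorted_filter; first by move=> ? ? ?; exact: ltn_trans.
    exact: sorted_enum_ord.
  - by move=> p; rewrite mem_filter mem_enum andbT.
rewrite /order_iso /= ; apply/forallP => x; apply/forallP => y.
case: x => -[|[|[|[|[|//]]]]] ? /=; case: y => -[|[|[|[|[|//]]]]] ? /=;
  rewrite label_at_lt // ?opener_mate // ?(opener_id oa) ?(opener_id ob) ?(opener_id oc);
  apply/eqP; lia.
Qed.

Lemma avoids_good M : is_matching M ->
  avoids M [:: 1; 2; 3; 1; 2] = good (matching_code M).
Proof.
move=> Mm; rewrite -[RHS]negbK; congr (~~ _).
have gI := mate_natP Mm.
apply/idP/idP => [/(contains_12312 Mm)[a [b [c [ab bc ca dab oc]]]]|].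
  apply/negP => /(good_code_of gI (leqnn _)) av.
  have := av (mate M a) b c (ltn_ord _).
  by rewrite !mate_natE mateK // => /(_ ab bc ca dab); lia.
apply: contraR => nc; apply/(good_code_of gI (leqnn _)) => q b c qN.
move=> ab bc cq; have [cN bN] : c < N /\ b < N by lia.
move: ab; rewrite -[q]/(val (Ordinal qN)) -[b]/(val (Ordinal bN)).
rewrite -[c]/(val (Ordinal cN)) !mate_natE => ab qb.
rewrite ltnNge; apply/negP; rewrite leq_eqVlt => /predU1P[/val_inj E|oc].
  by have [] := mateP (Ordinal cN) Mm; rewrite -E eqxx.
case/negP: nc; apply/(contains_12312 Mm).
by exists (mate M (Ordinal qN)), (Ordinal bN), (Ordinal cN); rewrite mateK.
Qed.

(** Each crossing is charged to the earlier of its two terminal points, [q], together with the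
    initial point [b] of the other edge. For fixed [q], these [b] are the stack entries above the
    edge closed at [q]. *)
Lemma crossings_ncross M : is_matching M ->
  crossings M = ncross (matching_code M).
Proof.
move=> Mm; rewrite /matching_code (ncross_code_of (mate_natP Mm)) //.
pose T := [set x : 'I_N * 'I_N | [&& mate M x.1 < x.1, mate M x.1 < x.2,
            x.2 < x.1 & x.1 < mate M x.2]].
pose phi (x : 'I_N * 'I_N) := [set (mate M x.1, x.1); (x.2, mate M x.2)].
have -> : crossings M = #|phi @: T|.
  rewrite /crossings; congr #|pred_of_set _|; apply/setP => Z.
  apply/imset2P/imsetP => [[[a q] [b d]]|[[q b]]].
    rewrite inE !in_edges //= => /andP[aq /eqP qE] /andP[/andP[bd /eqP dE] cr] ->.
    case/orP: cr => /= /and3P[c1 c2 c3].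
      exists (q, b); last by rewrite /phi /= -qE mateK // dE.
      by rewrite inE /= -qE mateK // qE dE aq c1 c2 c3.
    exists (d, a); last by rewrite /phi /= -dE mateK // qE setUC.
    by rewrite inE /= -dE mateK // qE dE bd c1 c2 c3.
  rewrite inE /= => /and4P[c1 c2 c3 c4] ->.
  exists (mate M q, q) (b, mate M b) => //.
    by rewrite in_edges //= c1 mateK // eqxx.
  rewrite inE in_edges //= eqxx andbT /cross /= c2 c3 c4 /= andbT.
  exact: ltn_trans c4.
rewrite card_in_imset; last first.
  move=> [q b] [q' b']; rewrite !inE /= => /and4P[c1 c2 c3 c4] /and4P[d1 d2 d3 d4] E.
  have := set21 (mate M q, q) (b, mate M b).
  have := set22 (mate M q, q) (b, mate M b).
  rewrite -[[set _; _]]/(phi (q, b)) E !inE !xpair_eqE /=.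
  case/orP => /andP[/eqP e1 /eqP e2] /orP[] /andP[/eqP e3 /eqP e4].
  - by move: c2; rewrite e1 e3 ltnn.
  - by move: c2 d2; rewrite e1 e3; lia.
  - by rewrite e1 e4.
  - by move: c2; rewrite e1 e3 ltnn.
rewrite -sum1_card.
(* The strict bound on [mate M x.2] may be weakened: equality with [x.1] would make [x.2] the mate
   of [x.1]. *)
rewrite (eq_bigl (fun x : 'I_N * 'I_N => (mate M x.1 < x.1) &&
  [&& mate M x.1 < x.2, x.2 < x.1 & x.1 <= mate M x.2])); last first.
  move=> [q b]; rewrite inE /=; apply: andb_id2l => _.
  apply: andb_id2l => qb; apply: andb_id2l => _.
  rewrite [RHS]leq_eqVlt orb_idl // => /eqP/val_inj qE.
  by move: qb; rewrite qE mateK // ltnn.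
rewrite -(pair_big_dep (fun q => mate M q < q)
  (fun q b : 'I_N => [&& mate M q < b, b < q & q <= mate M b]) (fun _ _ => 1)) /=.
apply: eq_big => [q|q _]; first by rewrite mate_natE.
rewrite -sum1_card (big_ord_widen_cond N
  (fun b => (mate_nat M q < b) && (q <= mate_nat M b)) (fun _ => 1))
  ?(ltnW (ltn_ord q)) //.
by apply: eq_bigl => b; rewrite !mate_natE -andbA [(b < q) && _]andbC.
Qed.

Lemma card_matchings_good_codes m :
  #|[set M : {set {set 'I_N}} |
       [&& is_matching M, avoids M [:: 1; 2; 3; 1; 2] & crossings M == m]]|
  = count (fun v => (size (stack v) == 0) && (ncross v == m)) (good_codes N).
Proof.
set A := [set M | _]; rewrite cardE -size_filter -(size_map (@matching_code)).
apply/perm_size/uniq_perm.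
- rewrite map_inj_in_uniq ?enum_uniq // => M M'; rewrite !mem_enum !inE.
  by move=> /andP[Mm _] /andP[Mm' _]; exact: matching_code_inj.
- by rewrite filter_uniq // good_codes_uniq.
move=> v; rewrite mem_filter good_codesP; apply/mapP/idP => [[M]|].
  rewrite mem_enum inE => /and3P[Mm]; rewrite avoids_good // crossings_ncross //.
  move=> gM cM ->; rewrite gM cM size_code_of eqxx.
  by rewrite /matching_code stack_code_of_full //; exact: mate_natP.
case/andP => /andP[/nilP sv cv] /andP[/eqP szv gv].
have [M Mm vE] := matching_code_surj szv (valid_good gv) sv.
exists M; last by rewrite vE.
by rewrite mem_enum inE Mm avoids_good // crossings_ncross // vE gv.
Qed.

End Matching.

(** * Counting good codes by crossings *)

Local Open Scope ring_scope.

(** Of the at most two entries that may be closed, only the one below the top, at index 1, leaves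
    the newest edge open. It is available iff [f] holds and [s] has at least two entries. *)
Lemma sum_fresh_closers (s : seq nat) (f : bool) c h : uniq s ->
  \sum_(a <- take f.+1 s | (size (rem a s) == h) && (f && (0 < index a s)%N))
     'X^(index a s + c)
  = (if [&& size s == h.+1, f & (0 < h)%N] then 'X * 'X^c else 0) :> {poly rat}.
Proof.
case: s => [|t [|u s]] /=; rewrite ?big_nil //.
  by rewrite big_cons big_nil /= eqxx !andbF eqSS; case: h => [|h]; rewrite ?andbF.
rewrite inE negb_or => /andP[/andP[tu _] _].
case: f; rewrite /= ?take0 !big_cons big_nil /= eqxx ?andbF ?(negPf tu) //=.
by rewrite eqxx /= eqSS addr0 add1n exprS andbT; case: h => [|h]; rewrite ?andbT.
Qed.

Lemma sum_closers (s : seq nat) (f : bool) c h : uniq s ->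
  \sum_(a <- take f.+1 s | size (rem a s) == h) 'X^(index a s + c)
  = (if size s == h.+1 then 'X^c else 0) +
    \sum_(a <- take f.+1 s | (size (rem a s) == h) && (f && (0 < index a s)%N))
     'X^(index a s + c)
    :> {poly rat}.
Proof.
case: s => [|t [|u s]] /=.
- by rewrite !big_nil addr0.
- by rewrite !big_cons !big_nil /= eqxx eqSS !andbF !addr0.
rewrite inE negb_or => /andP[/andP[tu _] _].
case: f; rewrite /= ?take0 !big_cons !big_nil /= eqxx ?andbF ?(negPf tu) //=.
  by rewrite eqxx /= eqSS andbT; case: (_.+1 == h); rewrite ?addr0 ?add0r.
by rewrite eqSS; case: (_.+1 == h); rewrite ?addr0 ?add0r.
Qed.

(** ['X] stands for q. After [p] points with [h] edges open, [(p + h) / 2] edges have been opened,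
    so this is the coefficient of that power of x in [S_h], and [fresh_crossing_poly] is the one in
    [B_h]. *)
Definition crossing_poly (p h : nat) : {poly rat} :=
  \sum_(v <- good_codes p | size (stack v) == h) 'X^(ncross v).

Definition fresh_crossing_poly (p h : nat) : {poly rat} :=
  \sum_(v <- good_codes p | (size (stack v) == h) && fresh v) 'X^(ncross v).

(** The newest edge is open after a step iff the step opened it, or it was open before and the entry
    just below it was closed. *)
Lemma fresh_crossing_polyS p h : fresh_crossing_poly p.+1 h =
  if h is h'.+1
  then crossing_poly p h' + 'X * fresh_crossing_poly p h.+1 else 0.
Proof.
rewrite /fresh_crossing_poly /crossing_poly /= big_flatten big_map /=.
case: h => [|h].
  rewrite big1 // => v _; rewrite /extensions big_cons /= big_map.
  by rewrite sum_fresh_closers ?stack_uniq //= !andbF.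
rewrite mulr_sumr [X in _ = X + _]big_mkcond [X in _ = _ + X]big_mkcond.
rewrite -big_split; apply: eq_bigr => v _ /=.
rewrite /extensions big_cons /= big_map andbT eqSS.
rewrite sum_fresh_closers ?stack_uniq // andbT.
by case: (size _ == h); rewrite ?add0r.
Qed.

(** The steps that leave the newest edge closed are exactly those that close the top of the stack,
    without a crossing. *)
Lemma crossing_polyS p h : crossing_poly p.+1 h =
  crossing_poly p h.+1 + fresh_crossing_poly p.+1 h.
Proof.
rewrite /crossing_poly /fresh_crossing_poly /= !big_flatten !big_map /=.
rewrite [X in _ = X + _]big_mkcond -big_split; apply: eq_bigr => v _ /=.
rewrite /extensions !big_cons /= !big_map andbT sum_closers ?stack_uniq //.
by case: (_.+1 == h); rewrite // addrCA.
Qed.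

(** * Closed forms and their recurrences *)

(** For [k > 0], the coefficient of y^j in (1 - y)^(-k), divided by [k]. *)
Definition rising_coef (k j : nat) : rat := 'C(k + j - 1, j)%:R / k%:R.

(* The binomial of [N] over [l - 1 - j], where truncated subtraction would
   give 1 instead of 0 for [l <= j]. *)
Definition bin_lo (N l j : nat) : nat := if (j < l)%N then 'C(N, l - j.+1) else 0%N.

(* Lagrange inversion, with [k = h + l] opened and [l] closed edges:
   [t^(k-h)] (h + t) (1 + t)^(3k-h) (1 - (q-1) t)^(-k) / k, at (q-1)^j. *)
Definition crossing_coef (h l j : nat) : rat :=
  rising_coef (h + l) j *
  (h%:R * 'C(2 * h + 3 * l, l - j)%:R + (bin_lo (2 * h + 3 * l) l j)%:R).

(** Lagrange inversion for [B_h] = (t / (1 + t))^h with [h > 0]: [t^(k-h)] h (1 + t)^(3k-h-1) (1 -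
    (q-1) t)^(-k) / k, at (q-1)^j. The factor [h] also gives [B_0 = 0]. *)
Definition fresh_crossing_coef (h l j : nat) : rat :=
  rising_coef (h + l) j * h%:R * 'C(2 * h + 3 * l - 1, l - j)%:R.

(** All three terms have [h + l.+1] opened edges, hence a common factor [rising_coef]; the rest is
    Pascal's rule. *)
Lemma crossing_coefS h l j : (j <= l)%N ->
  crossing_coef h l.+1 j =
  crossing_coef h.+1 l j + fresh_crossing_coef h l.+1 j.
Proof.
move=> jl; rewrite /crossing_coef /fresh_crossing_coef /bin_lo.
rewrite ltnS jl addSnnS subSS subSn //.
have -> : (2 * h + 3 * l.+1 = (2 * h + 3 * l).+3)%N by lia.
have -> : (2 * h.+1 + 3 * l = (2 * h + 3 * l).+2)%N by lia.
set N := (2 * h + 3 * l)%N; rewrite subn1 /= binS.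
case: ltnP => [lt|ge].
  have -> : (l - j)%N = (l - j.+1).+1 by lia.
  by rewrite (binS N.+2 (l - j.+1)) -(natr1 h) !natrD; ring.
have -> : (l - j)%N = 0%N by lia.
by rewrite !bin0 natrD -(natr1 h); ring.
Qed.

Lemma crossing_coefS_diag h l :
  crossing_coef h l.+1 l.+1 = fresh_crossing_coef h l.+1 l.+1.
Proof.
by rewrite /crossing_coef /fresh_crossing_coef /bin_lo ltnn subnn !bin0; ring.
Qed.

(** This is the recurrence for [B_(h+1)] at (q-1)^j. Writing q = 1 + (q-1) splits q [B_(h+2)] into a
    term at [j] and a term at [j.-1]. *)
Lemma fresh_crossing_coefS h l j : (0 < h + l)%N -> (j <= l)%N ->
  fresh_crossing_coef h.+1 l j =
  crossing_coef h l j +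
  (if (j < l)%N then fresh_crossing_coef h.+2 l.-1 j else 0) +
  (if (0 < j)%N then fresh_crossing_coef h.+2 l.-1 j.-1 else 0).
Proof.
move=> k0 jl; rewrite /crossing_coef /fresh_crossing_coef /bin_lo.
set k := (h + l)%N.
have kE : (h.+1 + l = k.+1)%N by [].
have kn0 : k%:R != 0 :> rat by rewrite pnatr_eq0 -lt0n.
have k1n0 : k.+1%:R != 0 :> rat by rewrite pnatr_eq0.
have kjn0 : (k + j)%:R != 0 :> rat by rewrite pnatr_eq0; lia.
have r1 : rising_coef k.+1 j = 'C(k + j, j)%:R / k.+1%:R.
  by rewrite /rising_coef addSn subn1.
have r2 : rising_coef k j = 'C(k + j, j)%:R / (k + j)%:R.
  rewrite /rising_coef subn1; apply/eqP; rewrite eqr_div //; apply/eqP.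
  rewrite -!natrM; congr (_%:R).
  by rewrite mulnC mul_bin_down addnK mulnC.
have r3 : (0 < j)%N ->
    rising_coef k.+1 j.-1 = j%:R * 'C(k + j, j)%:R / ((k + j)%:R * k.+1%:R).
  case: (j) kjn0 => // i kin0 _ /=; rewrite /rising_coef addSn subn1 /=.
  have := mul_bin_diag (k + i.+1) i; rewrite addnS /= => /(congr1 (fun n => n%:R : rat)).
  by rewrite !natrM => <-; field; rewrite -natrD !nat1r !pnatr_eq0.
pose N := (2 * h + 3 * l)%N.
pose X : rat := 'C(N, l - j)%:R.
pose Y : rat := (if (j < l)%N then 'C(N, l - j.+1) else 0%N)%:R.
(* All binomials reduce to ['C(k + j, j)] and the adjacent pair [X], [Y], which this relation
   links. *)
have XY : (l - j)%:R * X = (2 * k + j + 1)%:R * Y.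
  rewrite /X /Y; case: ltnP => [lt|ge]; last first.
    by have -> : (l - j)%N = 0%N; [lia | rewrite mul0r mulr0].
  rewrite -!natrM; congr (_%:R); have -> : (l - j)%N = (l - j.+1).+1 by lia.
  by rewrite mul_bin_left; congr (_ * _)%N; rewrite /N /k; lia.
have -> : 'C(2 * h.+1 + 3 * l - 1, l - j)%:R = X + Y.
  have -> : (2 * h.+1 + 3 * l - 1 = N.+1)%N by rewrite /N; lia.
  rewrite /X /Y; case: ltnP => [lt|ge].
    by have -> : (l - j)%N = (l - j.+1).+1; [lia | rewrite binS natrD].
  by have -> : (l - j)%N = 0%N; [lia | rewrite !bin0 addr0].
rewrite -[(2 * h + 3 * l)%N]/N -/X -/Y.
have -> : (if (j < l)%N then rising_coef (h.+2 + l.-1) j * h.+2%:R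
   * 'C(2 * h.+2 + 3 * l.-1 - 1, l.-1 - j)%:R else 0)
   = rising_coef k.+1 j * h.+2%:R * Y.
  rewrite /Y; case: ltnP => [lt|ge]; last by rewrite mulr0.
  have -> : (h.+2 + l.-1 = k.+1)%N by rewrite /k; lia.
  have -> : (2 * h.+2 + 3 * l.-1 - 1 = N)%N by rewrite /N; lia.
  by congr (_ * 'C(_, _)%:R); lia.
have -> : (if (0 < j)%N then rising_coef (h.+2 + l.-1) j.-1 * h.+2%:R
   * 'C(2 * h.+2 + 3 * l.-1 - 1, l.-1 - j.-1)%:R else 0)
   = j%:R * 'C(k + j, j)%:R / ((k + j)%:R * k.+1%:R) * h.+2%:R * X.
  rewrite /X; case: ltnP => [lt|]; last by rewrite leqn0 => /eqP->; rewrite !mul0r.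
  have -> : (h.+2 + l.-1 = k.+1)%N by rewrite /k; lia.
  have -> : (2 * h.+2 + 3 * l.-1 - 1 = N)%N by rewrite /N; lia.
  by rewrite r3 //; congr (_ * 'C(_, _)%:R); lia.
rewrite kE r1 r2; set Z : rat := 'C(k + j, j)%:R.
have kjE : (h + l + j)%:R = h%:R + (l - j)%:R + j%:R + j%:R :> rat.
  by rewrite -!natrD; congr (_%:R); lia.
have kE2 : k.+1%:R = h%:R + (l - j)%:R + j%:R + 1 :> rat.
  by rewrite -!natrD natr1; congr (_%:R); rewrite /k; lia.
have kE3 : (2 * k + j + 1)%:R =
    h%:R + (l - j)%:R + j%:R + h%:R + (l - j)%:R + j%:R + j%:R + 1 :> rat.
  by rewrite -!natrD natr1; congr (_%:R); rewrite /k; lia.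
move: k1n0 kjn0 XY; rewrite kjE kE2 kE3 => k1n0 kjn0 XY.
apply/eqP; rewrite -subr_eq0; apply/eqP.
move: XY => /eqP; rewrite -subr_eq0 => /eqP XY.
(* The difference of the two sides is [Z / (k.+1 * (k + j))] times the difference of the sides of
   [XY]. *)
rewrite -(mulr0 (Z / ((h%:R + (l - j)%:R + j%:R + 1)
  * (h%:R + (l - j)%:R + j%:R + j%:R)))) -XY.
by rewrite -!(natr1 h.+1) -(natr1 h); field; rewrite kjn0 k1n0.
Qed.

Definition crossing_sum (h l : nat) : {poly rat} :=
  \sum_(j < l.+1) crossing_coef h l j *: ('X - 1) ^+ j.

Definition fresh_crossing_sum (h l : nat) : {poly rat} :=
  \sum_(j < l.+1) fresh_crossing_coef h l j *: ('X - 1) ^+ j.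

Lemma crossing_sumS h l : crossing_sum h l =
  (if l is l'.+1 then crossing_sum h.+1 l' else 0) + fresh_crossing_sum h l.
Proof.
rewrite /crossing_sum /fresh_crossing_sum; case: l => [|l].
  rewrite !big_ord1 add0r /crossing_coef /fresh_crossing_coef /bin_lo /=.
  by rewrite !bin0 !mulr1 addr0.
rewrite [in LHS]big_ord_recr [X in _ = _ + X]big_ord_recr /= addrA -big_split /=.
rewrite crossing_coefS_diag; congr (_ + _); apply: eq_bigr => j _.
by rewrite -scalerDl -crossing_coefS // -ltnS.
Qed.

Lemma fresh_crossing_sumS h l : (0 < h + l)%N ->
  fresh_crossing_sum h.+1 l =
  crossing_sum h l + 'X * (if l is l'.+1 then fresh_crossing_sum h.+2 l' else 0).
Proof.
move=> hl; rewrite /crossing_sum /fresh_crossing_sum.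
under eq_bigr => j _ do rewrite (fresh_crossing_coefS hl (leq_ord j)) !scalerDl.
rewrite !big_split /= -addrA; congr (_ + _); case: l hl => [|l] hl.
  by rewrite !big_ord1 /= !scale0r mulr0 addr0.
(* The unshifted sum loses its last term and the shifted sum its first; they match the two parts of
   ['X = ('X - 1) + 1]. *)
rewrite [in X in X + _]big_ord_recr [in X in _ + X]big_ord_recl /= ltnn !scale0r.
rewrite addr0 add0r -[X in X * _](subrK 1) mulrDl mul1r addrC.
congr (_ + _); last by apply: eq_bigr => j _; rewrite ltn_ord.
rewrite mulr_sumr; apply: eq_bigr => j _.
by rewrite /= exprS -scalerAr.
Qed.

Lemma crossing_poly_gt p h : (p < h)%N -> crossing_poly p h = 0.
Proof.
move=> ph; rewrite /crossing_poly big_seq_cond big1 // => v.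
rewrite good_codesP => /andP[/andP[/eqP sz _] /eqP hE].
by have := size_stack v; rewrite sz hE leqNgt ph.
Qed.

Lemma fresh_crossing_poly_gt p h : (p < h)%N -> fresh_crossing_poly p h = 0.
Proof.
move=> ph; rewrite /fresh_crossing_poly big_seq_cond big1 // => v.
rewrite good_codesP => /andP[/andP[/eqP sz _] /andP[/eqP hE _]].
by have := size_stack v; rewrite sz hE leqNgt ph.
Qed.

(** The empty history is excluded: it contributes 1, whereas the closed form gives 0 at
    [h = l = 0]. *)
Lemma crossing_polys_closed_form p h l : p = (h + 2 * l)%N -> (0 < h + l)%N ->
  crossing_poly p h = crossing_sum h l /\
  fresh_crossing_poly p h = fresh_crossing_sum h l.
Proof.
elim: p h l => [|p IH] h l pE hl; first by lia.
have freshE : fresh_crossing_poly p.+1 h = fresh_crossing_sum h l.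
  rewrite fresh_crossing_polyS; case: h pE hl => [|h] pE hl.
    rewrite /fresh_crossing_sum big1 // => j _.
    by rewrite /fresh_crossing_coef mulr0 mul0r scale0r.
  (* A single opened edge comes from the empty history, which the induction hypothesis does not
     cover. *)
  have [/eqP|hl0] := posnP (h + l)%N.
    rewrite addn_eq0 => /andP[/eqP h0 /eqP l0]; rewrite {}h0 {}l0 in pE *.
    have {pE} -> : p = 0%N by lia.
    rewrite fresh_crossing_poly_gt // mulr0 addr0 /crossing_poly big_cons big_nil.
    rewrite /fresh_crossing_sum big_ord1 /fresh_crossing_coef /rising_coef.
    by rewrite !bin0 /= divr1 !mulr1 scale1r addr0.
  rewrite fresh_crossing_sumS // (proj1 (IH h l _ hl0)); last by lia.
  case: l pE hl hl0 => [|l] pE hl hl0; first by rewrite fresh_crossing_poly_gt //; lia.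
  by rewrite (proj2 (IH h.+2 l _ _)) //; lia.
split=> //; rewrite crossing_polyS freshE crossing_sumS; congr (_ + _).
case: l pE hl {freshE} => [|l] pE hl; first by rewrite crossing_poly_gt //; lia.
by rewrite (proj1 (IH h.+1 l _ _)) //; lia.
Qed.

(** * Extraction of the number of matchings with [m] crossings *)

Lemma coef_Xsub1_exp (j m : nat) :
  (('X - 1) ^+ j : {poly rat})`_m = (-1) ^+ (j + m) * 'C(j, m)%:R.
Proof.
rewrite addrC exprDn coef_sum.
have [jm|mj] := ltnP j m.
  rewrite bin_small // mulr0 big1 // => i _; rewrite -polyCN -polyC_exp coefMn coefCM.
  by rewrite coefXn gtn_eqF ?mulr0 ?mul0rn // (leq_ltn_trans _ jm) // -ltnS.
rewrite (bigD1 (inord m)) //= inordK ?ltnS // big1 => [|i im].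
  rewrite addr0 coefMn -polyCN -polyC_exp coefCM coefXn eqxx mulr1.
  by rewrite -[in LHS]signr_odd oddB // -oddD signr_odd mulr_natr.
rewrite coefMn -polyCN -polyC_exp coefCM coefXn.
rewrite (_ : (m == i) = false) ?mulr0 ?mul0rn //.
by apply: contraNF im => /eqP ->; rewrite inord_val.
Qed.

Lemma count_good_codes n m : (0 < n)%N ->
  (count (fun v => (size (stack v) == 0) && (ncross v == m))%N
     (good_codes (2 * n)))%:R
  = \sum_(n <= i < 2 * n)
      (-1) ^+ (n + m + i) / i%:R * 'C(i, n)%:R * 'C(3 * n, i + 1 + n)%:R
        * 'C(i - n, m)%:R :> rat.
Proof.
move=> n0.
transitivity ((crossing_poly (2 * n) 0)`_m).
  rewrite /crossing_poly coef_sum -sum1_count natr_sum big_mkcond.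
  rewrite [RHS]big_mkcond /=; apply: eq_bigr => v _.
  by rewrite coefXn [m == _]eq_sym; case: (size (stack v) == 0)%N; case: (ncross v == m).
rewrite (proj1 (@crossing_polys_closed_form _ 0 n _ _)) // /crossing_sum.
(* At [h = 0] the term [j = n] vanishes; the others match the stated sum under [i = j + n]. *)
rewrite coef_sum big_ord_recr /= coefZ /crossing_coef /bin_lo ltnn.
rewrite !mul0r addr0 mulr0 mul0r addr0.
rewrite [index_iota n _](_ : _ = index_iota (0 + n) (2 * n)) // big_addn.
rewrite (_ : 2 * n - n = n)%N; last by lia.
rewrite big_mkord; apply: eq_bigr => j _.
rewrite coefZ coef_Xsub1_exp ltn_ord mul0r !add0r addnK mulrA; congr (_ * _).
have jn := ltn_ord j.
have -> : 'C(3 * n, j + n + 1 + n) = 'C(3 * n, n - j.+1).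
  by rewrite -bin_sub; [congr ('C(_, _)) | ]; lia.
(* Absorption turns [rising_coef n j] into ['C(i, n) / i] with [i = j + n]. *)
have E : (j + n)%:R * 'C((n + j).-1, j)%:R = n%:R * 'C(j + n, n)%:R :> rat.
  rewrite -!natrM addnC mul_bin_down addnK; congr (_ * _)%:R.
  by rewrite -bin_sub ?leq_addl // addnK.
have jn0 : (j + n)%:R != 0 :> rat by rewrite pnatr_eq0; lia.
have n0' : n%:R != 0 :> rat by rewrite pnatr_eq0; lia.
have F : 'C((n + j).-1, j)%:R / n%:R = 'C(j + n, n)%:R / (j + n)%:R :> rat.
  by apply/eqP; rewrite eqr_div // mulrC E mulrC.
have -> : (-1) ^+ (n + m + (j + n)) = (-1) ^+ (j + m) :> rat.
  have -> : (n + m + (j + n) = (j + m) + n * 2)%N by lia.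
  by rewrite exprD exprM sqrr_sign mulr1.
by rewrite /rising_coef muln0 !add0n subn1 F; ring.
Qed.

Theorem theorem1 (n m : nat) (hn : (1 <= n)%N) :
  (#|[set M : {set {set 'I_(2 * n)}} |
       [&& is_matching M, avoids M [:: 1; 2; 3; 1; 2]%N & crossings M == m]]|)%:R
  = \sum_(n <= i < 2 * n)
      (-1) ^+ (n + m + i) / i%:R * 'C(i, n)%:R * 'C(3 * n, i + 1 + n)%:R
        * 'C(i - n, m)%:R :> rat.
Proof. by rewrite card_matchings_good_codes count_good_codes. Qed.
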